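(* Let $A\in\mathbb{Z}^{m\times n}$ have full row rank $m$, let $x^0\in\mathbb{Z}^n$, and let $X=\{x\in\mathbb{Z}^n \mid Ax=Ax^0\}$. Suppose that $P\in\mathbb{Z}^{(m+s)\times n}$ and $M\in\mathbb{Z}^{m\times(m+s)}$ satisfy $A=MP$. If $T\in\mathbb{Z}^{(m+s)\times s}$ is a lattice basis of $L(N(M))$, then $X=X^{P,T}$.
   Context: For an integer matrix $M$, $N(M)=\{y \text{ real} \mid My=0\}$ is its null space and $L(N(M))$ is the lattice of all integer vectors in $N(M)$. A matrix is called a lattice basis of a lattice if its columns form a basis of that lattice (linearly independent vectors whose integer combinations are exactly the lattice). For $P\in\mathbb{Z}^{(m+s)\times n}$, $T\in\mathbb{Z}^{(m+s)\times s}$ and the fixed $x^0\in\mathbb{Z}^n$, $$X^{P,T}=\{x\in\mathbb{Z}^n \mid \text{there exists } \mu\in\mathbb{Z}^s \text{ with } Px=Px^0+T\mu\}.$$ *)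

(* Defs.v *)
From mathcomp Require Import all_boot all_order all_algebra.
From mathcomp Require Import boolp classical_sets reals.

Set Implicit Arguments.
Unset Strict Implicit.
Unset Printing Implicit Defensive.

Import GRing.Theory.
Local Open Scope ring_scope.
Local Open Scope classical_set_scope.

(** Vectors are column vectors; [R] is the field of real numbers, into which
    integer matrices are mapped entrywise. *)

Definition real_mx (R : realType) (p q : nat) (A : 'M[int]_(p, q)) :
  'M[R]_(p, q) := map_mx intr A.

Definition null_space (R : realType) (p q : nat) (M : 'M[int]_(p, q)) :
  set 'cV[R]_q := [set y | real_mx R M *m y = 0].
Arguments null_space R {p q} M.

Definition integer_vectors (R : realType) (q : nat) (V : set 'cV[R]_q) :
  set 'cV[int]_q := [set z | V (real_mx R z)].

(** The columns of [T] are linearly independent over the reals (stated as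
    freeness of the rows of the transpose), and [L] is exactly the set of
    their integer combinations [T *m mu]. *)
Definition lattice_basis (R : realType) (q s : nat) (T : 'M[int]_(q, s))
    (L : set 'cV[int]_q) : Prop :=
  row_free (real_mx R T)^T /\
  L = [set T *m mu | mu in [set: 'cV[int]_s]].

Definition feasible_set (m n : nat) (A : 'M[int]_(m, n)) (x0 : 'cV[int]_n) :
  set 'cV[int]_n := [set x | A *m x = A *m x0].

Definition feasible_set_PT (q n s : nat) (P : 'M[int]_(q, n))
    (T : 'M[int]_(q, s)) (x0 : 'cV[int]_n) : set 'cV[int]_n :=
  [set x | exists mu : 'cV[int]_s, P *m x = P *m x0 + T *m mu].

(* Main.v *)
Require Import Defs.
From mathcomp Require Import all_boot all_order all_algebra.
From mathcomp Require Import boolp classical_sets reals.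

(** A vector [x] is feasible iff [M *m (P *m x - P *m x0) = 0], that is, iff
    the integer vector [P *m x - P *m x0] lies in the null space of [M]
    ([feasible_setE]).  As the columns of [T] generate the integer points of
    that null space, this says that [P *m x - P *m x0 = T *m mu] for some
    integer [mu], which is membership in the reformulated set.  Nullity over
    the reals and over the integers agree because the embedding of the
    integers is an injective ring morphism ([integer_null_spaceE]). *)

Import GRing.Theory Num.Theory.
Local Open Scope ring_scope.

Lemma integer_null_spaceE (R : realType) (p q : nat) (M : 'M[int]_(p, q))
    (z : 'cV[int]_q) :
  integer_vectors (null_space R M) z <-> M *m z = 0.
Proof.
rewrite /integer_vectors /null_space /real_mx /= -map_mxM.
split=> [/matrixP Mz0 | ->]; last by rewrite map_mx0.
by apply/matrixP=> i j; move: (Mz0 i j); rewrite !mxE => /eqP; rewrite intr_eq0 => /eqP.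
Qed.

Lemma feasible_setE (R : realType) (m n q : nat) (M : 'M[int]_(m, q))
    (P : 'M[int]_(q, n)) (x0 x : 'cV[int]_n) :
  feasible_set (M *m P) x0 x <->
  integer_vectors (null_space R M) (P *m x - P *m x0).
Proof.
rewrite integer_null_spaceE mulmxBr !mulmxA /feasible_set /=.
by split=> [-> | /subr0_eq //]; rewrite subrr.
Qed.

Theorem proposition3 (R : realType) (m n s : nat)
    (A : 'M[int]_(m, n)) (x0 : 'cV[int]_n)
    (P : 'M[int]_(m + s, n)) (M : 'M[int]_(m, m + s))
    (T : 'M[int]_(m + s, s))
    (rankA : \rank (real_mx R A) = m)
    (A_eq_MP : A = M *m P)
    (T_basis : lattice_basis R T (integer_vectors (null_space R M))) :
  feasible_set A x0 = feasible_set_PT P T x0.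
Proof.
case: T_basis => _ lattE; apply/seteqP; rewrite A_eq_MP.
split=> x; rewrite (feasible_setE R) lattE /feasible_set_PT /=.
  by case=> mu _ Tmu; exists mu; rewrite Tmu addrC subrK.
by case=> mu ->; exists mu; rewrite // addrC addKr.
Qed.
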